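(* For $m\geq 2$, \begin{equation*} \Gamma_{i}^{\left[\substack{s\\ s+m}\right]\times i} = \begin{cases} 2^{2s+2i+m-2} - 3\cdot 2^{3i-4} + 2^{2i-3} & \text{if } 1\leq i\leq s+1,\\ 2^{2s+2i+m-2} - 3\cdot 2^{3i-4} + 2^{3i-s-4} & \text{if } s+2\leq i\leq s+m+1,\\ 2^{2s+2i+m-2} - 3\cdot 2^{3i-4} + 2^{4i-2s-m-5} & \text{if } s+m+2\leq i\leq 2s+m. \end{cases} \end{equation*}
   Context: $\Gamma_{i}^{\left[\substack{s\\ s+m}\right]\times k}$ denotes the number of rank $i$ matrices over $\mathbb{F}_2$ of the form $\left[\frac{A}{B}\right]$ where $A$ is an $s\times k$ persymmetric matrix and $B$ an $(s+m)\times k$ persymmetric matrix over $\mathbb{F}_2$; here $k=i$. *)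

(* Defs.v *)
From HB Require Import structures.
From mathcomp Require Export all_boot all_order all_algebra.

Set Implicit Arguments.
Unset Strict Implicit.
Unset Printing Implicit Defensive.

Import GRing.Theory.
Local Open Scope ring_scope.

(* For rectangular matrices, "persymmetric" means constant along the
   anti-diagonals (Hankel), not symmetric about the anti-diagonal. *)
Definition persymmetric (R : eqType) (p k : nat) (A : 'M[R]_(p, k)) : bool :=
  [forall a : 'I_p, forall b : 'I_k, forall c : 'I_p, forall d : 'I_k,
     ((a + b)%N == (c + d)%N) ==> (A a b == A c d)].

(* In the usual notation: lower index i, row sizes s over s + m, k columns. *)
Definition Gamma (i s m k : nat) : nat :=
  #|[set M : 'M['F_2]_(s + (s + m), k) |
      [exists A : 'M['F_2]_(s, k), exists B : 'M['F_2]_(s + m, k),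
         [&& persymmetric A, persymmetric B & M == col_mx A B]]
      && (\rank M == i)]|.

(* Main.v *)
(* Identify a Hankel matrix with a linear form b on polynomials: f is in its
   kernel iff b (f g) = 0 for all g of small size. The Euclidean algorithm shows
   that the forms f apolar to b are, in every degree, the combinations
   u p + v q of two coprime forms p, q whose degrees c, d add up to the length
   of b plus one. Fixing the lower block b, the kernel of the stacked matrix is
   therefore that of two Hankel blocks, placed side by side, of the independent
   uniform forms p.a and q.a. Fixing in turn the larger of two adjacent blocks
   leads, by duality, back to stacked blocks of smaller size; hence an induction
   in which both probabilities of full column rank only depend on the sizes.
   No sum over the value of c is needed: every conditional probability is a
   linear combination of the numbers 2^((k-c)+(k-d)) of apolar forms of degree
   k - 1, whose averages follow from a first-moment count. *)
Require Import Defs.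
From mathcomp Require Import all_boot all_order all_algebra.
From mathcomp Require Import zify ring.

Set Implicit Arguments.
Unset Strict Implicit.
Unset Printing Implicit Defensive.

Import GRing.Theory Num.Theory.
Local Open Scope ring_scope.

(** * Apolar forms of a Hankel matrix *)

Section Apolar.
Variable F : fieldType.
Implicit Types f g p q u v r t B : {poly F}.

Lemma size_polyD_le f g k :
  (size f <= k)%N -> (size g <= k)%N -> (size (f + g)%R <= k)%N.
Proof. by move=> szf szg; rewrite (leq_trans (size_polyD _ _)) // geq_max szf. Qed.

Lemma size_polyM_le f g k c :
  (size f <= k.+1 - c)%N -> (size g <= c)%N -> (size (f * g)%R <= k)%N.
Proof.
move=> szf szg; case: (eqVneq f 0) => [->|f0]; first by rewrite mul0r size_poly0.
case: (eqVneq g 0) => [->|g0]; first by rewrite mulr0 size_poly0.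
by move: f0 g0 (size_polyMleq f g); rewrite -!size_poly_gt0; lia.
Qed.

(** The extended Euclidean algorithm on ['X^N] and [B], stopped once the remainder is shorter than
    its cofactor. The last two rows keep determinant ['X^N]. *)
Lemma euclid_basis N B : exists t1 r1 t2 r2,
  [/\ 'X^N %| t1 * B - r1, 'X^N %| t2 * B - r2, (size t1 <= size r1)%N,
      (size r2 < size t2)%N & t2 * r1 - t1 * r2 = 'X^N].
Proof.
suff main n : forall t1 r1 t2 r2, (size r2 <= n)%N ->
    'X^N %| t1 * B - r1 -> 'X^N %| t2 * B - r2 -> (size t1 <= size r1)%N ->
    t2 * r1 - t1 * r2 = 'X^N -> exists t1 r1 t2 r2,
  [/\ 'X^N %| t1 * B - r1, 'X^N %| t2 * B - r2, (size t1 <= size r1)%N,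
      (size r2 < size t2)%N & t2 * r1 - t1 * r2 = 'X^N].
  apply: (main (size B) 0 'X^N 1 B) => //.
  - by rewrite mul0r sub0r dvdpNr.
  - by rewrite mul1r subrr dvdp0.
  - by rewrite size_poly0.
  - by rewrite mul1r mul0r subr0.
have XN0 : 'X^N != 0 :> {poly F} by rewrite -size_poly_eq0 size_polyXn.
elim: n => [|n IHn] t1 r1 t2 r2 szr2 d1 d2 sz1 det.
all: case: (ltnP (size r2) (size t2)) => [lt2|le2]; first by exists t1, r1, t2, r2.
all: have r2N0 : r2 != 0.
  1,3: apply: contraNneq XN0 => r20; move: le2 det; rewrite r20 size_poly0 leqn0.
  1,2: by rewrite size_poly_eq0 => /eqP->; rewrite mul0r mulr0 subrr => <-.
  by move: szr2; rewrite leqn0 size_poly_eq0 (negPf r2N0).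
(* The new row is the negative of the usual one, so that the determinant does not change sign. *)
apply: (IHn t2 r2 (r1 %/ r2 * t2 - t1) (r1 %/ r2 * r2 - r1)) => //.
- have -> : r1 %/ r2 * r2 - r1 = - (r1 %% r2).
    by rewrite {2}(divp_eq r1 r2) opprD addrA subrr sub0r.
  by rewrite size_polyN -ltnS (leq_trans _ szr2) // ltn_modp.
- have -> : (r1 %/ r2 * t2 - t1) * B - (r1 %/ r2 * r2 - r1) =
     r1 %/ r2 * (t2 * B - r2) - (t1 * B - r1) by ring.
  by rewrite dvdp_addl ?dvdpNr // dvdp_mull.
- by rewrite -det; ring.
Qed.

(** * Linear forms on polynomials and kernels of Hankel matrices *)

Definition ev N (a : 'rV[F]_N) f : F := \sum_(i < N) a 0 i * f`_i.

(** The coefficient vector of [f] is in the kernel of the Hankel matrix with [m] rows and entries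
    [ev a 'X^(i + j)]. *)
Definition kill N (a : 'rV[F]_N) (m : nat) f : bool :=
  [forall j : 'I_m, ev a (f * 'X^j) == 0].

Lemma evD N (a : 'rV_N) f g : ev a (f + g) = ev a f + ev a g.
Proof. by rewrite -big_split /=; apply: eq_bigr => i _; rewrite coefD mulrDr. Qed.

Lemma evZ N (a : 'rV_N) k f : ev a (k *: f) = k * ev a f.
Proof. by rewrite mulr_sumr; apply: eq_bigr => i _; rewrite coefZ mulrCA. Qed.

Lemma ev_sum N (a : 'rV_N) n (G : 'I_n -> {poly F}) :
  ev a (\sum_i G i) = \sum_i ev a (G i).
Proof.
rewrite [RHS]exchange_big; apply: eq_bigr => i _.
by rewrite coef_sum mulr_sumr.
Qed.

Lemma ev_Dl N (a b : 'rV_N) f : ev (a + b) f = ev a f + ev b f.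
Proof. by rewrite -big_split /=; apply: eq_bigr => i _; rewrite mxE mulrDl. Qed.

Lemma evXn N (a : 'rV_N) (i : 'I_N) : ev a 'X^i = a 0 i.
Proof.
rewrite /ev (bigD1 i) //= coefXn eqxx mulr1 big1 ?addr0 // => j ji.
by rewrite coefXn (inj_eq val_inj) (negPf ji) mulr0.
Qed.

Lemma poly_small_sum n g : (size g <= n)%N -> g = \sum_(j < n) g`_j *: 'X^j.
Proof.
move=> szg; rewrite -poly_def; apply/polyP => i; rewrite coef_poly.
by case: ltnP => // /(leq_trans szg) /(nth_default 0).
Qed.

Lemma killP N (a : 'rV_N) m f :
  reflect (forall g, (size g <= m)%N -> ev a (f * g) = 0) (kill a m f).
Proof.
apply: (iffP forallP) => [H g szg|H j]; last first.
  by rewrite H // size_polyXn.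
rewrite (poly_small_sum szg) mulr_sumr ev_sum big1 // => j _.
by rewrite -scalerAr evZ (eqP (H j)) mulr0.
Qed.

Lemma evE N (a : 'rV_N) f : ev a f = \sum_(0 <= i < N) ev a 'X^i * f`_i.
Proof. by rewrite big_mkord; apply: eq_bigr => i _; rewrite evXn. Qed.

(** Reversing the sequence turns its pairings with shifts of [f] into coefficients of an ordinary
    product. *)
Definition rev_poly N (b : 'rV[F]_N) := \poly_(i < N) ev b 'X^(N - i.+1).

Lemma ev_rev_coef N (b : 'rV_N) f j :
  (j < N)%N -> ev b (f * 'X^j) = (f * rev_poly b)`_(N - j.+1).
Proof.
move=> ltjN; rewrite coefM evE (@big_cat_nat _ _ _ j) //=; last exact: ltnW.
rewrite big_nat big1 ?add0r; last first.
  by move=> i /= ltij; rewrite coefMXn ltij mulr0.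
rewrite -{1}[j]add0n big_addn big_mkord.
have -> : (N - j.+1).+1 = (N - j)%N by lia.
apply: eq_bigr => i _; have lti := ltn_ord i.
rewrite coefMXn ifF; last by lia.
rewrite addnK coef_poly ifT; last by lia.
by rewrite mulrC; congr (_ * ev b 'X^_); lia.
Qed.

(** The key equation of rational approximation: the [m] pairings are the top coefficients of
    [f * rev_poly b] modulo ['X^N]. *)
Lemma kill_take_poly N (b : 'rV_N) m f : (m <= N)%N ->
  kill b m f = (size (take_poly N (f * rev_poly b)) <= N - m)%N.
Proof.
move=> lerN; apply/forallP/leq_sizeP => [H i lei|H j]; rewrite ?coef_take_poly.
  case: ltnP => // ltiN; have ltr : (N - i.+1 < m)%N by lia.
  have := H (Ordinal ltr); rewrite ev_rev_coef /=; last by lia.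
  have -> : (N - (N - i.+1).+1 = i)%N by lia.
  by move/eqP.
have ltj := ltn_ord j; rewrite ev_rev_coef; last by lia.
have := H (N - j.+1)%N; rewrite coef_take_poly ifT; last by lia.
by move=> -> //; lia.
Qed.

(* Weighted predictable-degree property of the reduced basis. *)
Lemma size_basis_comb t1 r1 t2 r2 u v k :
  (0 < size r1)%N -> (size t1 <= size r1)%N -> (size r2 < size t2)%N ->
  (size (u * t1 + v * t2)%R <= k)%N -> (size (u * r1 + v * r2)%R <= k.-1)%N ->
  (size u <= k - size r1)%N /\ (size v <= k - (size t2).-1)%N.
Proof.
move=> r10 le1 lt2 szf szr.
have t20 : (0 < size t2)%N by lia.
have nz (p : {poly F}) : (0 < size p)%N -> p != 0 by rewrite size_poly_gt0.
have szM (a b : {poly F}) m : (0 < size a)%N -> (size b <= m)%N ->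
    (size (a * b)%R <= size a + m.-1)%N.
  by have := size_polyMleq a b; lia.
have szME (a b : {poly F}) : (0 < size a)%N -> (0 < size b)%N ->
    size (a * b) = (size a + size b).-1.
  by move=> a0 b0; rewrite size_mul ?nz.
case: (posnP (size v)) => [|v0].
  move/eqP; rewrite size_poly_eq0 => /eqP v0; move: szr; rewrite v0 mul0r addr0 size_poly0.
  case: (posnP (size u)) => [->|u0] //; rewrite szME //; lia.
case: (posnP (size u)) => [|u0].
  move/eqP; rewrite size_poly_eq0 => /eqP u0; move: szf; rewrite u0 mul0r add0r size_poly0.
  by rewrite szME //; lia.
have l1 := szM u _ _ u0 le1; have l2 := szME v _ v0 t20.
have l3 := szM v r2 (size t2).-1 v0 ltac:(lia); have l4 := szME u _ u0 r10.
(* In the first case [v * t2] dominates the first combination, in the second [u * r1] dominates the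
   other one; no cancellation can occur. *)
have [cmp|cmp] := leqP (size u + size r1) (size v + (size t2).-1).
  by move: szf; rewrite addrC size_polyDl; lia.
have l5 : (size (v * r2)%R < size (u * r1)%R)%N.
  by have := size_polyMleq v r2; lia.
by move: szr; rewrite size_polyDl; lia.
Qed.

(* The forms of degree [k - 1] (polynomials of size at most [k]) apolar to [b]
   are the degree-[k - 1] part of the ideal generated by two coprime forms
   [p], [q] of degrees [c], [d]; the last clause is coprimality. *)
Definition apolar_gens N (b : 'rV[F]_N) (c d : nat) p q : Prop :=
  [/\ (c + d)%N = N.+1, (size p <= c.+1)%N, (size q <= d.+1)%N,
   forall k f, (k <= N.+1)%N ->
     (size f <= k)%N && kill b (N.+1 - k) f <->
     exists u v, [/\ (size u <= k - c)%N, (size v <= k - d)%N & f = u * p + v * q] &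
   forall u v, (size u <= d)%N -> (size v <= c)%N ->
     u * p + v * q = 0 -> u = 0 /\ v = 0].

Lemma apolar_gensC N (b : 'rV[F]_N) c d p q :
  apolar_gens b c d p q -> apolar_gens b d c q p.
Proof.
case=> cd szp szq gen ind; split=> //; first by rewrite addnC.
  move=> k f lek; rewrite gen //; split=> -[u [v [? ? ->]]]; exists v, u;
  by rewrite addrC.
by move=> u v szu szv; rewrite addrC => /(ind _ _ szv szu) [].
Qed.

(** The generators are the cofactors of the two Euclidean rows. An apolar [f] has a short residue
    [r], the pair [(f, r)] is a combination of these rows, and the predictable degrees bound its
    coefficients. *)
Lemma apolar_gens_exist N (b : 'rV[F]_N) :
  exists c d p q, (c <= d)%N /\ apolar_gens b c d p q.
Proof.
suff [c [d [p [q H]]]] : exists c d p q, apolar_gens b c d p q.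
  case: (leqP c d) => cd; first by exists c, d, p, q.
  by exists d, c, q, p; split; [exact: ltnW | exact: apolar_gensC].
set B := rev_poly b.
have [t1 [r1 [t2 [r2 [d1 d2 le1 lt2 det]]]]] := euclid_basis N B.
have XN0 : 'X^N != 0 :> {poly F} by rewrite -size_poly_eq0 size_polyXn.
have r10 : (0 < size r1)%N.
  rewrite lt0n; apply: contraNneq XN0 => r10; rewrite -det.
  move: (r10) le1 => /eqP; rewrite size_poly_eq0 => /eqP->.
  by rewrite size_poly0 leqn0 size_poly_eq0 => /eqP->; rewrite mulr0 mul0r subrr.
have t20 : (0 < size t2)%N by lia.
have nz (p : {poly F}) : (0 < size p)%N -> p != 0 by rewrite size_poly_gt0.
(* In the determinant, [t2 * r1] is strictly longer than [t1 * r2]. *)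
have cd : (size r1 + (size t2).-1)%N = N.+1.
  have s1 : size (t2 * r1) = (size t2 + size r1).-1 by rewrite size_mul ?nz.
  have s2 := size_polyMleq t1 r2.
  have s3 : size (t2 * r1 - t1 * r2) = N.+1 by rewrite det size_polyXn.
  have s4 : (size (- (t1 * r2))%R < size (t2 * r1)%R)%N
    by rewrite size_polyN; apply: leq_ltn_trans s2 _; rewrite s1; lia.
  by move: s3; rewrite (size_polyDl s4) s1; lia.
exists (size r1), (size t2).-1, t1, t2; split=> //; try by lia.
  move=> [|k] f lek.
    split=> [/andP[]|[u [v []]]].
      rewrite leqn0 size_poly_eq0 => /eqP-> _; exists 0, 0.
      by rewrite !mul0r addr0 size_poly0.
    rewrite !sub0n !leqn0 !size_poly_eq0 => /eqP-> /eqP-> ->.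
    rewrite !mul0r addr0 eqxx; apply/forallP => j.
    by rewrite mul0r /ev big1 // => i _; rewrite coef0 mulr0.
  rewrite kill_take_poly; last by lia.
  have -> : (N - (N.+1 - k.+1) = k.+1.-1)%N by lia.
  split=> [/andP[szf szr]|[u [v [szu szv ->]]]].
    set r := take_poly N (f * B) in szr.
    have dr : 'X^N %| f * B - r.
      by rewrite -[X in X - r](poly_take_drop N) addrC addKr dvdp_mull.
    (* Cramer's rule: both numerators are multiples of the determinant ['X^N], so the coordinates
       [u] and [v] are polynomials. *)
    have /dvdpP[u Eu] : 'X^N %| t2 * r - f * r2.
      have -> : t2 * r - f * r2 = f * (t2 * B - r2) - t2 * (f * B - r) by ring.
      by rewrite dvdp_addl ?dvdpNr dvdp_mull.
    have /dvdpP[v Ev] : 'X^N %| f * r1 - t1 * r.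
      have -> : f * r1 - t1 * r = t1 * (f * B - r) - f * (t1 * B - r1) by ring.
      by rewrite dvdp_addl ?dvdpNr dvdp_mull.
    have Ef : f = u * t1 + v * t2.
      apply: (mulIf XN0); rewrite mulrDl ![_ * _ * 'X^N]mulrAC -Eu -Ev -det; ring.
    have Er : r = u * r1 + v * r2.
      apply: (mulIf XN0); rewrite mulrDl ![_ * _ * 'X^N]mulrAC -Eu -Ev -det; ring.
    rewrite Er in szr; rewrite {1}Ef in szf.
    have [su sv] := size_basis_comb r10 le1 lt2 szf szr.
    by exists u, v.
  have szr : (size (u * r1 + v * r2)%R <= k)%N.
    apply: size_polyD_le; first exact: size_polyM_le szu _.
    by apply: size_polyM_le szv _; lia.
  apply/andP; split.
    apply: size_polyD_le.
      by apply: (@size_polyM_le _ _ _ (size r1).+1); lia.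
    by apply: (@size_polyM_le _ _ _ (size t2).-1.+1); lia.
  have /dvdpP[w Ew] : 'X^N %| (u * t1 + v * t2) * B - (u * r1 + v * r2).
    have -> : (u * t1 + v * t2) * B - (u * r1 + v * r2) =
      u * (t1 * B - r1) + v * (t2 * B - r2) by ring.
    by rewrite dvdp_addl dvdp_mull.
  have -> : (u * t1 + v * t2) * B = (u * r1 + v * r2) + w * 'X^N.
    by rewrite -Ew; ring.
  by rewrite take_polyDMXn // (leq_trans szr); lia.
move=> u v szu szv f0.
have szr : (size (u * r1 + v * r2)%R <= N)%N.
  apply: size_polyD_le; first by apply: (@size_polyM_le _ _ _ (size r1)); lia.
  by apply: (@size_polyM_le _ _ _ (size t2).-1); lia.
(* A multiple of ['X^N] of size at most [N] vanishes; the degree bounds for [k = 0] then force [u]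
   and [v] to be zero. *)
have r0 : u * r1 + v * r2 = 0.
  have dr : 'X^N %| u * r1 + v * r2.
    have -> : u * r1 + v * r2 =
      (u * t1 + v * t2) * B - (u * (t1 * B - r1) + v * (t2 * B - r2)) by ring.
    by rewrite f0 mul0r sub0r dvdpNr dvdp_addl dvdp_mull.
  apply: contraTeq szr => rN0; have := dvdp_leq rN0 dr.
  by rewrite size_polyXn -ltnNge.
have [] := @size_basis_comb t1 r1 t2 r2 u v 0 r10 le1 lt2.
- by rewrite f0 size_poly0.
- by rewrite r0 size_poly0.
by rewrite !sub0n !leqn0 !size_poly_eq0 => /eqP-> /eqP->.
Qed.

(** * Contraction of a linear form: the transpose of multiplication by [p] *)

Definition contract p n N (a : 'rV[F]_N) : 'rV[F]_n := \row_i ev a ('X^i * p).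

Lemma ev_contract p n N (a : 'rV[F]_N) g :
  (size g <= n)%N -> ev (contract p n a) g = ev a (g * p).
Proof.
move=> szg; rewrite [in RHS](poly_small_sum szg) mulr_suml ev_sum.
by apply: eq_bigr => i _; rewrite mxE -scalerAl evZ mulrC.
Qed.

Lemma contractD p n N (a b : 'rV[F]_N) :
  contract p n (a + b) = contract p n a + contract p n b.
Proof. by apply/rowP => i; rewrite !mxE ev_Dl. Qed.

Lemma rVpoly_sum n (x : 'rV[F]_n) : rVpoly x = \sum_i x 0 i *: 'X^i.
Proof.
rewrite {1}(poly_small_sum (size_poly _ _ : size (rVpoly x) <= n)%N).
by apply: eq_bigr => i _; rewrite coef_rVpoly_ord.
Qed.

(* Dual of the injectivity of [(u, v) |-> u * p + v * q]. *)
Lemma contract_surj p q n1 n2 N (w1 : 'rV[F]_n1) (w2 : 'rV[F]_n2) :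
  (forall u v, (size u <= n1)%N -> (size v <= n2)%N ->
     (size (u * p + v * q)%R <= N)%N /\ (u * p + v * q = 0 -> u = 0 /\ v = 0)) ->
  exists a : 'rV[F]_N, contract p n1 a = w1 /\ contract q n2 a = w2.
Proof.
move=> inj.
pose S := col_mx (\matrix_(i < n1, j < N) ('X^i * p)`_j)
                 (\matrix_(i < n2, j < N) ('X^i * q)`_j).
have frS : row_free S.
  apply/inj_row_free => x xS.
  have [szN] := inj _ _ (size_poly _ _ : size (rVpoly (lsubmx x)) <= n1)%N
    (size_poly _ _ : size (rVpoly (rsubmx x)) <= n2)%N.
  case.
    apply/polyP => j; rewrite coef0; case: (ltnP j N) => [ltj|lej]; last first.
      by rewrite nth_default // (leq_trans szN).
    move/rowP/(_ (Ordinal ltj)): xS; rewrite -[x in LHS]hsubmxK mul_row_col !mxE.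
    apply: etrans; rewrite !rVpoly_sum coefD !mulr_suml !coef_sum.
    by congr (_ + _); apply: eq_bigr => i _; rewrite -scalerAl coefZ !mxE.
  have rp0 n (y : 'rV[F]_n) : rVpoly y = 0 -> y = 0.
    by move=> y0; rewrite -(rVpolyK y) y0 linear0.
  by move=> /rp0 x1 /rp0 x2; rewrite -[x]hsubmxK x1 x2 row_mx0.
pose a := (pinvmx S *m (row_mx w1 w2)^T)^T; exists a.
have Sa : S *m a^T = (row_mx w1 w2)^T.
  by rewrite trmxK mulmxA mulmxVp // mul1mx.
move: Sa; rewrite tr_row_mx /S mul_col_mx => /eq_col_mx[S1 S2].
split; apply/rowP => i; rewrite mxE.
  move/colP/(_ i): S1; rewrite !mxE => <-.
  by apply: eq_bigr => j _; rewrite !mxE mulrC.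
move/colP/(_ i): S2; rewrite !mxE => <-.
by apply: eq_bigr => j _; rewrite !mxE mulrC.
Qed.

End Apolar.

(** * Averages over binary sequences *)

Definition avg (T : finType) (h : T -> rat) : rat := (\sum_x h x) / #|T|%:R.

Lemma eq_avg (T : finType) (h h' : T -> rat) : h =1 h' -> avg h = avg h'.
Proof. by move=> eqh; rewrite /avg; congr (_ / _); apply: eq_bigr. Qed.

Lemma avgD (T : finType) (h h' : T -> rat) :
  avg (fun x => h x + h' x) = avg h + avg h'.
Proof. by rewrite /avg big_split mulrDl. Qed.

Lemma avgZ (T : finType) k (h : T -> rat) : avg (fun x => k * h x) = k * avg h.
Proof. by rewrite /avg -mulr_sumr mulrA. Qed.

Lemma avg_sum (T I : finType) (h : I -> T -> rat) :
  avg (fun x => \sum_i h i x) = \sum_i avg (h i).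
Proof. by rewrite /avg exchange_big -mulr_suml. Qed.

Lemma avg_const (T : finType) k : (0 < #|T|)%N -> avg (fun _ : T => k) = k.
Proof.
move=> T0; rewrite /avg sumr_const -[k *+ _]mulr_natr mulfK //.
by rewrite pnatr_eq0 -lt0n.
Qed.

Lemma avg_swap (T U : finType) (h : T -> U -> rat) :
  avg (fun x => avg (h x)) = avg (fun y => avg (h^~ y)).
Proof.
rewrite /avg -!mulr_suml exchange_big -!mulrA; congr (_ * _).
by rewrite mulrC.
Qed.

Section Binary.
Local Notation F := 'F_2.
Implicit Types f g p q u v t : {poly F}.

Lemma card_F2rV n : #|{: 'rV[F]_n}| = (2 ^ n)%N.
Proof. by rewrite card_mx card_ord mul1n. Qed.

Lemma card_F2rV_gt0 n : (0 < #|{: 'rV[F]_n}|)%N.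
Proof. by rewrite card_F2rV expn_gt0. Qed.

(** A surjective additive map sends the uniform law to the uniform law: by surjectivity every
    translation of the image preserves the average, and one then averages over all translations. *)
Lemma avg_push N n1 n2 (phi : 'rV[F]_N -> 'rV[F]_n1) (psi : 'rV[F]_N -> 'rV[F]_n2)
    (h : 'rV[F]_n1 -> 'rV[F]_n2 -> rat) :
  (forall a b, phi (a + b) = phi a + phi b) ->
  (forall a b, psi (a + b) = psi a + psi b) ->
  (forall w1 w2, exists a, phi a = w1 /\ psi a = w2) ->
  avg (fun a => h (phi a) (psi a)) = avg (fun w1 => avg (h w1)).
Proof.
move=> phiD psiD surj.
have transl (w1 : 'rV_n1) (w2 : 'rV_n2) :
  avg (fun a => h (phi a) (psi a)) = avg (fun a => h (phi a + w1) (psi a + w2)).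
  have [b [<- <-]] := surj w1 w2; rewrite /avg; congr (_ / _).
  by rewrite (reindex_inj (addIr b)); apply: eq_bigr => a _; rewrite phiD psiD.
rewrite -[LHS](avg_const _ (card_F2rV_gt0 n2)) -[LHS](avg_const _ (card_F2rV_gt0 n1)).
under eq_avg => w1 do under eq_avg => w2 do rewrite (transl w1 w2).
under eq_avg => w1 do rewrite avg_swap.
rewrite avg_swap.
rewrite -[RHS](avg_const _ (card_F2rV_gt0 N)); apply: eq_avg => a.
rewrite /avg; congr (_ / _).
rewrite [RHS](reindex_inj (addrI (phi a))); apply: eq_bigr => w1 _.
congr (_ / _); rewrite [RHS](reindex_inj (addrI (psi a))).
by [].
Qed.

Lemma avg_push1 N n1 (phi : 'rV[F]_N -> 'rV[F]_n1) (h : 'rV[F]_n1 -> rat) :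
  (forall a b, phi (a + b) = phi a + phi b) ->
  (forall w1, exists a, phi a = w1) ->
  avg (fun a => h (phi a)) = avg h.
Proof.
move=> phiD surj.
rewrite (@avg_push _ _ 0 phi (fun _ => 0) (fun w1 _ => h w1)) //.
- by apply: eq_avg => w; rewrite avg_const // card_F2rV_gt0.
- by move=> *; rewrite addr0.
by move=> w1 w2; have [a <-] := surj w1; exists a; rewrite (thinmx0 w2).
Qed.

(** * Counting apolar forms and their first moment *)

Definition apolar_count N (b : 'rV[F]_N) k : nat :=
  #|[set f : 'rV[F]_k | kill b (N.+1 - k) (rVpoly f)]|.

Lemma size_rVpoly n (f : 'rV[F]_n) : (size (rVpoly f) <= n)%N.
Proof. exact: size_poly. Qed.

Lemma rVpoly_eq0 n (f : 'rV[F]_n) : (rVpoly f == 0) = (f == 0).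
Proof.
apply/eqP/eqP => [f0|->]; last exact: linear0.
by rewrite -(rVpolyK f) f0 linear0.
Qed.

(** The pair [(u, v)] is a coordinate system on the apolar forms; it is injective because
    [k - c <= d] and [k - d <= c]. *)
Lemma apolar_countE N (b : 'rV[F]_N) c d p q k : apolar_gens b c d p q ->
  (k <= N.+1)%N -> apolar_count b k = (2 ^ ((k - c) + (k - d)))%N.
Proof.
move=> [cd szp szq gen ind] lek.
pose G (x : 'rV[F]_(k - c) * 'rV[F]_(k - d)) : 'rV[F]_k :=
  poly_rV (rVpoly x.1 * p + rVpoly x.2 * q).
have GE x : rVpoly (G x) = rVpoly x.1 * p + rVpoly x.2 * q /\
    kill b (N.+1 - k) (rVpoly (G x)).
  have /andP[sz kl] : (size (rVpoly x.1 * p + rVpoly x.2 * q)%R <= k)%N &&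
      kill b (N.+1 - k) (rVpoly x.1 * p + rVpoly x.2 * q).
    by apply/gen => //; exists (rVpoly x.1), (rVpoly x.2); rewrite !size_rVpoly.
  by rewrite /G poly_rV_K.
have injG : injective G.
  move=> x y Gxy; have := (GE x).1; rewrite Gxy (GE y).1 => /eqP.
  rewrite -subr_eq0 opprD addrACA -!mulrBl -!raddfB => /eqP H.
  have [] := ind _ _ _ _ H.
  - by apply: leq_trans (size_rVpoly _) _; lia.
  - by apply: leq_trans (size_rVpoly _) _; lia.
  move=> /eqP + /eqP; rewrite !rVpoly_eq0 !subr_eq0 => /eqP E1 /eqP E2.
  by rewrite (surjective_pairing x) (surjective_pairing y) E1 E2.
rewrite /apolar_count; have -> : [set f | kill b (N.+1 - k) (rVpoly f)] = G @: setT.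
  apply/setP => f; rewrite !inE; apply/idP/imsetP => [kf|[x _ ->]]; last exact: (GE x).2.
  have /gen : (size (rVpoly f) <= k)%N && kill b (N.+1 - k) (rVpoly f).
    by rewrite size_rVpoly.
  case=> // u [v [szu szv E]]; exists (poly_rV u, poly_rV v) => //.
  by rewrite /G /= !poly_rV_K // -E rVpolyK.
by rewrite card_imset // cardsT card_prod !card_F2rV expnD.
Qed.

(** Multiplication by [f] is injective, so the contraction of a uniform [b] by [f] is uniform on
    vectors of length [m]. *)
Lemma avg_kill N m k f : f != 0 -> (size f <= k)%N -> (k + m <= N.+1)%N ->
  avg (fun b : 'rV[F]_N => (kill b m f)%:R) = (2 ^+ m)^-1.
Proof.
move=> f0 szf lek.
have E (b : 'rV[F]_N) : kill b m f = (contract f m b == 0).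
  apply/forallP/eqP => [H|H j].
    by apply/rowP => j; rewrite !mxE mulrC; apply/eqP/H.
  by move/rowP/(_ j): H; rewrite !mxE mulrC => ->.
under eq_avg => b do rewrite E.
rewrite (@avg_push1 _ _ (@contract _ f m N) (fun w => (w == 0)%:R)).
- rewrite /avg card_F2rV (bigD1 0) //= eqxx big1 ?addr0 ?mul1r ?natrX //.
  by move=> w /negPf ->.
- exact: contractD.
move=> w; have [|a [? _]] := @contract_surj _ f 0 m 0 N w 0; last by exists a.
move=> u v szu szv; rewrite mulr0 addr0; split.
  apply: (@size_polyM_le _ u f N k) => //; lia.
move=> /eqP; rewrite mulf_eq0 (negPf f0) orbF => /eqP ->; split=> //.
by apply/eqP; rewrite -size_poly_eq0 -leqn0.
Qed.

(** The zero form always counts; each of the [2 ^ k - 1] others is killed with probability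
    [2 ^ -(N.+1 - k)]. *)
Lemma avg_apolar_count N k : (k <= N.+1)%N ->
  avg (fun b : 'rV[F]_N => (apolar_count b k)%:R) = 1 + (2 ^+ k - 1) * 2 ^+ k / 2 ^+ N.+1.
Proof.
move=> lek.
have E (b : 'rV[F]_N) :
    (apolar_count b k)%:R = \sum_(f : 'rV[F]_k) (kill b (N.+1 - k) (rVpoly f))%:R :> rat.
  rewrite /apolar_count -sum1_card natr_sum big_mkcond; apply: eq_bigr => f _.
  by rewrite inE; case: ifP.
under eq_avg => b do rewrite E.
rewrite avg_sum (bigD1 0) //=; congr (_ + _).
  rewrite -[RHS](avg_const _ (card_F2rV_gt0 N)); apply: eq_avg => b.
  rewrite linear0; case: killP => // -[] g _.
  by rewrite mul0r /ev big1 // => i _; rewrite coef0 mulr0.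
rewrite (eq_bigr (fun _ => (2 ^+ (N.+1 - k))^-1)); last first.
  by move=> f f0; rewrite (avg_kill _ (size_rVpoly f)) ?rVpoly_eq0 // subnKC.
rewrite sumr_const; have -> : #|[pred f : 'rV[F]_k | f != 0]| = (2 ^ k - 1)%N.
  by rewrite -card_F2rV -(cardC (pred1 0)) card1 add1n subn1.
rewrite -[_ *+ (2 ^ k - 1)]mulr_natl natrB ?expn_gt0 // natrX -mulrA; congr (_ * _).
have {2}-> : N.+1 = (k + (N.+1 - k))%N by lia.
by rewrite exprD invfM mulrA divff ?mul1r // expf_neq0.
Qed.

(** * Stacked and adjacent Hankel blocks *)

(* The Hankel blocks of [a] and [b], with [X] and [Y] rows, stacked on
   [k] common columns have full column rank. *)
Definition stacked_free X Y k n1 n2 (a : 'rV[F]_n1) (b : 'rV[F]_n2) : bool :=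
  [forall f : 'rV[F]_k, kill a X (rVpoly f) && kill b Y (rVpoly f) ==> (f == 0)].

(* The Hankel blocks of [a] and [b], with [k] and [l] columns, placed
   side by side on [X] common rows have full column rank. *)
Definition adjacent_free k l X n1 n2 (a : 'rV[F]_n1) (b : 'rV[F]_n2) : bool :=
  [forall f : 'rV[F]_k, forall g : 'rV[F]_l,
     [forall j : 'I_X, ev a ('X^j * rVpoly f) + ev b ('X^j * rVpoly g) == 0] ==>
     (f == 0) && (g == 0)].

Lemma stacked_freeP X Y k n1 n2 (a : 'rV[F]_n1) (b : 'rV[F]_n2) :
  reflect (forall f, (size f <= k)%N -> kill a X f -> kill b Y f -> f = 0)
          (stacked_free X Y k a b).
Proof.
apply: (iffP forallP) => H f.
  move=> szf ka kb; have := H (poly_rV f); rewrite poly_rV_K // ka kb /=.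
  by rewrite -rVpoly_eq0 poly_rV_K // => /eqP.
apply/implyP => /andP[ka kb]; rewrite -rVpoly_eq0; apply/eqP.
by apply: H => //; exact: size_rVpoly.
Qed.

Lemma adjacent_freeP k l X n1 n2 (a : 'rV[F]_n1) (b : 'rV[F]_n2) :
  reflect (forall f g, (size f <= k)%N -> (size g <= l)%N ->
     (forall t, (size t <= X)%N -> ev a (t * f) + ev b (t * g) = 0) ->
     f = 0 /\ g = 0)
    (adjacent_free k l X a b).
Proof.
apply: (iffP forallP) => [H f g szf szg rel|H f].
  have := forallP (H (poly_rV f)) (poly_rV g); rewrite !poly_rV_K //.
  have -> : [forall j : 'I_X, ev a ('X^j * f) + ev b ('X^j * g) == 0].
    by apply/forallP => j; rewrite rel // size_polyXn.
  by rewrite -!rVpoly_eq0 !poly_rV_K // => /andP[/eqP-> /eqP->].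
apply/forallP => g; apply/implyP => /forallP rel.
have [] := H (rVpoly f) (rVpoly g).
- exact: size_rVpoly.
- exact: size_rVpoly.
- move=> t szt; rewrite (poly_small_sum szt) !mulr_suml !ev_sum -big_split big1 //=.
  by move=> j _; rewrite -!scalerAl !evZ -mulrDr (eqP (rel j)) mulr0.
by move=> /eqP + /eqP; rewrite !rVpoly_eq0 => -> ->.
Qed.

(* With no column the length must be [0], not [X.-1]: no entry is involved. *)
Definition flen X k : nat := if k is 0 then 0%N else (X + k).-1.

Lemma flenE X k : (0 < k)%N -> flen X k = (X + k).-1.
Proof. by case: k. Qed.

Lemma size_flen X k t f : (size t <= X)%N -> (size f <= k)%N ->
  (size (t * f)%R <= flen X k)%N.
Proof.
case: k => [|k] szt szf /=.
  move: szf; rewrite leqn0 size_poly_eq0 => /eqP->.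
  by rewrite mulr0 size_poly0.
apply: (@size_polyM_le _ t f _ k.+1) => //; apply: leq_trans szt _; lia.
Qed.

Definition stacked_prob X Y k : rat :=
  avg (fun a : 'rV[F]_(X + k).-1 => avg (fun b : 'rV[F]_(Y + k).-1 =>
    (stacked_free X Y k a b)%:R)).

Definition adjacent_prob k l X : rat :=
  avg (fun a : 'rV[F]_(flen X k) => avg (fun b : 'rV[F]_(flen X l) =>
    (adjacent_free k l X a b)%:R)).

(** Kernel vectors of the block of [b] are [u * p + v * q], and [a] pairs with them through its
    contractions by [p] and [q], which are independent and uniform. *)
Lemma avg_stacked_free X Y k M N (b : 'rV[F]_N) c d p q :
  (X <= Y)%N -> (0 < k)%N -> M.+1 = (X + k)%N -> N.+1 = (Y + k)%N ->
  apolar_gens b c d p q ->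
  avg (fun a : 'rV[F]_M => (stacked_free X Y k a b)%:R) = adjacent_prob (k - c) (k - d) X.
Proof.
move=> leXY k0 EM EN [cd szp szq gen ind].
have ENk : (N.+1 - k)%N = Y by lia.
pose n1 := flen X (k - c); pose n2 := flen X (k - d).
have E (a : 'rV[F]_M) : stacked_free X Y k a b =
    adjacent_free (k - c) (k - d) X (contract p n1 a) (contract q n2 a).
  apply/stacked_freeP/adjacent_freeP => [H f g szf szg rel|H f szf ka kb].
    have /andP[szs kb] : (size (f * p + g * q)%R <= k)%N &&
        kill b (N.+1 - k) (f * p + g * q) by apply/gen; [lia | exists f, g].
    rewrite ENk in kb.
    apply: ind; [apply: leq_trans szf _; lia | apply: leq_trans szg _; lia |].
    apply: H => //; apply/killP => t szt.
    rewrite mulrDl evD -(rel t szt) !ev_contract ?size_flen //.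
    by congr (ev a _ + ev a _); ring.
  have [f1 [f2 [sz1 sz2 Ef]]] : exists f1 f2,
      [/\ (size f1 <= k - c)%N, (size f2 <= k - d)%N & f = f1 * p + f2 * q].
    by apply/gen; [lia | rewrite ENk szf].
  have [] := H f1 f2 sz1 sz2; last by rewrite Ef => -> ->; rewrite !mul0r addr0.
  move=> t szt; rewrite !ev_contract ?size_flen // -evD.
  rewrite -(killP _ _ _ ka t szt) Ef; congr (ev a _); ring.
under eq_avg => a do rewrite E.
rewrite (@avg_push M n1 n2 (@contract _ p n1 M) (@contract _ q n2 M)
  (fun x y => (adjacent_free (k - c) (k - d) X x y)%:R)) //; try exact: contractD.
move=> w1 w2; apply: contract_surj => u v szu szv.
(* Since [X <= Y] and [c + d = Y + k], these lengths are at most [d] and [c], within the range of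
   coprimality. *)
have fl r : (flen X (k - r) <= X + k - r.+1)%N.
  by rewrite /flen; case E1: (k - r)%N => //; lia.
have [l1 l2] := (fl c, fl d).
split.
  apply: size_polyD_le.
    by apply: (@size_polyM_le _ u p M c.+1) => //; apply: leq_trans szu _; lia.
  by apply: (@size_polyM_le _ v q M d.+1) => //; apply: leq_trans szv _; lia.
by apply: ind; [apply: leq_trans szu _; lia | apply: leq_trans szv _; lia].
Qed.

(** Double orthogonality: a functional vanishing on the kernel of the Hankel matrix of [h] is in its
    row space; [g] holds the coefficients of the rows. *)
Lemma hankel_row_dual X l M N (a : 'rV[F]_M) (h : 'rV[F]_N) f :
  (forall t, (size t <= X)%N -> kill h l t -> ev a (t * f) = 0) ->
  exists2 g : {poly F}, (size g <= l)%N &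
    forall t, (size t <= X)%N -> ev a (t * f) = ev h (t * g).
Proof.
move=> van.
pose H := \matrix_(i < l, j < X) ev h ('X^j * 'X^i).
pose phi := \row_(j < X) ev a ('X^j * f).
have : (phi <= H)%MS.
  rewrite submxE; apply/eqP/rowP => j; rewrite !mxE.
  pose t := rVpoly (\row_i cokermx H i j).
  have szt : (size t <= X)%N by exact: size_rVpoly.
  transitivity (ev a (t * f)).
    rewrite /t rVpoly_sum mulr_suml ev_sum; apply: eq_bigr => i _.
    by rewrite -scalerAl evZ !mxE mulrC.
  apply: van => //; apply/forallP => i; apply/eqP.
  move: (mulmx_coker H) => /matrixP/(_ i j); rewrite !mxE => <-.
  rewrite /t rVpoly_sum mulr_suml ev_sum; apply: eq_bigr => r _.
  by rewrite -scalerAl evZ !mxE mulrC.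
case/submxP => D ED; exists (rVpoly D); first exact: size_rVpoly.
have key (j : 'I_X) : ev a ('X^j * f) = ev h ('X^j * rVpoly D).
  move/rowP/(_ j): ED; rewrite !mxE => ->.
  rewrite (poly_small_sum (size_rVpoly D)) mulr_sumr ev_sum.
  by apply: eq_bigr => i _; rewrite coef_rVpoly_ord mxE -scalerAr evZ.
move=> t szt; rewrite (poly_small_sum szt) !mulr_suml !ev_sum.
by apply: eq_bigr => j _; rewrite -!scalerAl !evZ key.
Qed.

(** If [c < l], then [p] is a dependency among the columns of [h]. Otherwise these are independent,
    and a dependency amounts to a nonzero [f] for which [t |-> a (t f)] vanishes on the apolar
    [t = u * p + v * q]: a stacked problem for the contractions of [a]. *)
Lemma avg_adjacent_free k l X M N (h : 'rV[F]_N) c d p q :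
  (0 < k <= l)%N -> M.+1 = (X + k)%N -> N.+1 = (X + l)%N -> (c <= d)%N ->
  apolar_gens h c d p q ->
  avg (fun a : 'rV[F]_M => (adjacent_free k l X a h)%:R) =
  if (l <= c)%N then stacked_prob (X - d) (X - c) k else 0.
Proof.
move=> /andP[k0 lekl] EM EN lecd gens; have [cd szp szq gen ind] := gens.
have ENX : (N.+1 - X)%N = l by lia.
have ENl : (N.+1 - l)%N = X by lia.
case: (leqP l c) => lc; last first.
  rewrite -[RHS](avg_const _ (card_F2rV_gt0 M)); apply: eq_avg => a.
  case: adjacent_freeP => // H; exfalso.
  have /andP[szp' kp] : (size (1 * p + 0 * q)%R <= l)%N && kill h (N.+1 - l) (1 * p + 0 * q).
    apply/gen; first by lia.
    by exists 1, 0; rewrite size_poly1 size_poly0; split => //; lia.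
  have [|||_ p0] := H 0 (1 * p + 0 * q) => //; first by rewrite size_poly0.
    move=> t szt; rewrite mulr0 [X in X + _]/ev big1 ?add0r; last first.
      by move=> i _; rewrite coef0 mulr0.
    by rewrite mulrC; apply/killP: t szt; rewrite -ENl.
  have [] := ind 1 0 _ _ p0; rewrite ?size_poly1 ?size_poly0; try lia.
  by move/eqP; rewrite oner_eq0.
pose n1 := (X - d + k).-1; pose n2 := (X - c + k).-1.
have E (a : 'rV[F]_M) : adjacent_free k l X a h =
    stacked_free (X - d) (X - c) k (contract q n1 a) (contract p n2 a).
  have szM m t f : (size t <= m)%N -> (size f <= k)%N -> (size (f * t)%R <= (m + k).-1)%N.
    by move=> szt szf; rewrite mulrC -(flenE m k0); apply: size_flen.
  apply/adjacent_freeP/stacked_freeP => [H f szf kq kp|H f g szf szg rel].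
    have [|g szg Eg] := @hankel_row_dual X l M N a h f.
      move=> t szt kt; have : exists u v,
          [/\ (size u <= X - c)%N, (size v <= X - d)%N & t = u * p + v * q].
        by apply/gen; [lia | rewrite szt ENX].
      case=> u [v [szu szv ->]].
      have := killP _ _ _ kp u szu; rewrite ev_contract ?szM // => E1.
      have := killP _ _ _ kq v szv; rewrite ev_contract ?szM // => E2.
      rewrite mulrDl evD -[RHS]addr0 -{1}E1 -E2.
      by congr (ev a _ + ev a _); ring.
    have [] // := H f (- g) => //; first by rewrite size_polyN.
    by move=> t szt; rewrite mulrN -scaleN1r evZ mulN1r (Eg t szt) subrr.
  have f0 : f = 0.
    (* Testing the relation on multiples of [q], then of [p], removes the term in [h]. *)
    apply: H => //; apply/killP => t szt; rewrite ev_contract ?szM //.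
      have /andP[szs ks] : (size (0 * p + t * q)%R <= X)%N && kill h (N.+1 - X) (0 * p + t * q).
        by apply/gen; [lia | exists 0, t; rewrite size_poly0].
      rewrite ENX mul0r add0r in szs ks; have := rel _ szs.
      rewrite (killP _ _ _ ks g szg) addr0 => <-.
      by congr (ev a _); ring.
    have /andP[szs ks] : (size (t * p + 0 * q)%R <= X)%N && kill h (N.+1 - X) (t * p + 0 * q).
      by apply/gen; [lia | exists t, 0; rewrite size_poly0].
    rewrite ENX mul0r addr0 in szs ks; have := rel _ szs.
    rewrite (killP _ _ _ ks g szg) addr0 => <-.
    by congr (ev a _); ring.
  split=> //; have : exists u v,
      [/\ (size u <= l - c)%N, (size v <= l - d)%N & g = u * p + v * q].
    apply/gen; [lia | rewrite szg ENl; apply/killP => t szt].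
    have := rel t szt; rewrite f0 mulr0 [X in X + _]/ev big1 ?add0r; last first.
      by move=> i _; rewrite coef0 mulr0.
    by rewrite mulrC.
  have [-> ->] : (l - c = 0 /\ l - d = 0)%N by lia.
  case=> u [v []]; rewrite !leqn0 !size_poly_eq0 => /eqP-> /eqP-> ->.
  by rewrite !mul0r addr0.
under eq_avg => a do rewrite E.
rewrite (@avg_push M n1 n2 (@contract _ q n1 M) (@contract _ p n2 M)
  (fun x y => (stacked_free (X - d) (X - c) k x y)%:R)) //; try exact: contractD.
move=> w1 w2; apply: contract_surj => u v szu szv; split.
  apply: size_polyD_le.
    by apply: (@size_polyM_le _ u q M d.+1) => //; apply: leq_trans szu _; lia.
  by apply: (@size_polyM_le _ v p M c.+1) => //; apply: leq_trans szv _; lia.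
rewrite addrC => /ind[] //; first by apply: leq_trans szv _; lia.
by apply: leq_trans szu _; lia.
Qed.

Lemma adjacent_probC k l X : adjacent_prob k l X = adjacent_prob l k X.
Proof.
rewrite /adjacent_prob avg_swap; apply: eq_avg => b; apply: eq_avg => a.
suff -> : adjacent_free k l X a b = adjacent_free l k X b a by [].
by apply/adjacent_freeP/adjacent_freeP => H f g szf szg rel; have [] := H g f szg szf;
   move=> // t szt; rewrite addrC rel.
Qed.

(** * Probabilities of full column rank *)

Lemma pow2_neq0 n : 2 ^+ n != 0 :> rat.
Proof. by rewrite expf_neq0. Qed.

Lemma apolar_count_natr N (b : 'rV[F]_N) c d p q k : apolar_gens b c d p q ->
  (k <= N.+1)%N -> (apolar_count b k)%:R = 2 ^+ ((k - c) + (k - d)) :> rat.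
Proof. by move=> gens lek; rewrite (apolar_countE gens lek) natrX. Qed.

Lemma adjacent_prob_0_0 X : adjacent_prob 0 0 X = 1.
Proof.
rewrite /adjacent_prob -[RHS](avg_const _ (card_F2rV_gt0 (flen X 0))).
apply: eq_avg => a; rewrite -[RHS](avg_const _ (card_F2rV_gt0 (flen X 0))).
apply: eq_avg => b; case: adjacent_freeP => // -[] f g.
by rewrite !leqn0 !size_poly_eq0 => /eqP-> /eqP->.
Qed.

Lemma adjacent_free_l0 k X N (a : 'rV[F]_N) (b : 'rV[F]_0) c d p q :
  (0 < k)%N -> N.+1 = (X + k)%N -> (c <= d)%N -> apolar_gens a c d p q ->
  adjacent_free k 0 X a b = (k <= c)%N.
Proof.
move=> k0 EN lecd [cd szp szq gen ind].
have ENk : (N.+1 - k)%N = X by lia.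
have ev0 (h : {poly F}) : ev b h = 0 by rewrite /ev big_ord0.
apply/adjacent_freeP/idP => [H|lekc f g szf szg rel].
  case: leqP => // ltck; exfalso.
  have /andP[szp' kp] : (size (1 * p + 0 * q)%R <= k)%N &&
      kill a (N.+1 - k) (1 * p + 0 * q).
    apply/gen; first by lia.
    by exists 1, 0; rewrite size_poly1 size_poly0; split => //; lia.
  have [|||p0 _] := H (1 * p + 0 * q) 0 => //; first by rewrite size_poly0.
    move=> t szt; rewrite ev0 addr0 mulrC.
    by apply/killP: t szt; rewrite -ENk.
  have [] := ind 1 0 _ _ p0; rewrite ?size_poly1 ?size_poly0; try lia.
  by move/eqP; rewrite oner_eq0.
split; last by move: szg; rewrite leqn0 size_poly_eq0 => /eqP.
have : exists u v : {poly F}, [/\ (size u <= k - c)%N, (size v <= k - d)%N & f = u * p + v * q].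
  apply/gen; [lia | rewrite szf ENk; apply/killP => t szt].
  by have := rel t szt; rewrite ev0 addr0 mulrC.
have [-> ->] : (k - c = 0 /\ k - d = 0)%N by lia.
case=> u [v []]; rewrite !leqn0 !size_poly_eq0 => /eqP-> /eqP-> ->.
by rewrite !mul0r addr0.
Qed.

Lemma adjacent_prob_l0 k X : (0 < k)%N ->
  adjacent_prob k 0 X = if (k <= X)%N then 1 - 2 ^+ k / 2 ^+ X.+1 else 0.
Proof.
case: k => // k _; set N := flen X k.+1.
have EN : N.+1 = (X + k.+1)%N by rewrite /N /=; lia.
(* As [k.+1 <= d], both counts depend on [c] alone; the combination is 1 for [k < c] and cancels for
   [c <= k]. *)
have E (a : 'rV[F]_N) : avg (fun b : 'rV[F]_(flen X 0) => (adjacent_free k.+1 0 X a b)%:R) =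
    if (k < X)%N then 2 * (apolar_count a k)%:R + -1 * (apolar_count a k.+1)%:R else 0.
  have [c [d [p [q [lecd gens]]]]] := apolar_gens_exist a.
  have cd : (c + d)%N = N.+1 by case: gens.
  under eq_avg => b do rewrite (adjacent_free_l0 b _ EN lecd gens) //.
  rewrite avg_const ?card_F2rV_gt0 //; case: (ltnP k X) => [ltkX|leXk]; last first.
    by have -> : (k < c)%N = false by lia.
  rewrite !(apolar_count_natr gens); try lia.
  have -> : (k - d = 0)%N by lia.
  have -> : (k.+1 - d = 0)%N by lia.
  rewrite !addn0; case: ltnP => [ltkc|leck].
    have [-> ->] : (k - c = 0 /\ k.+1 - c = 0)%N by lia.
    by rewrite expr0 /=; ring.
  by rewrite subSn // exprS /=; ring.
rewrite /adjacent_prob; under eq_avg => a do rewrite E.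
case: ltnP => ltkX; last by rewrite avg_const ?card_F2rV_gt0.
rewrite avgD !avgZ !avg_apolar_count; try lia.
rewrite EN !exprD !exprS; have := (pow2_neq0 k, pow2_neq0 X).
by case=> k0 X0; field; rewrite k0 X0.
Qed.

(** This is [(1 - 2^-(d+1)) (1 - 2^-(d+2))], where [d] is the excess of rows over columns. *)
Definition adjacent_val d : rat := 1 - 3 / 2 ^+ (d + 2) + (2 ^+ (d + 1 + (d + 2)))^-1.

(** Again [d] is the excess of rows over columns. The three arguments of the minimum yield the three
    cases of the theorem. *)
Definition stacked_val d k X : rat :=
  1 - 3 / 2 ^+ (d + 2) + (2 ^+ (d + 1 + minn k (minn X.+1 (d + 2))))^-1.

(** Here [d] is at least the number of columns, so at most the block of [p] survives. The right-hand
    side uses apolar counts with coefficients independent of [c] and [d], ready for averaging over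
    the lower block. *)
Lemma adjacent_prob_gens_few_cols X Y n c d :
  (X <= Y)%N -> (n <= Y)%N -> (c <= d)%N -> (c + d)%N = (Y + n.+1)%N ->
  adjacent_prob (n.+1 - c) (n.+1 - d) X =
  (2 ^+ X)^-1 * (2 ^+ ((n - c) + (n - d)) + -1 * 2 ^+ ((n.+1 - c) + (n.+1 - d))) +
  2 ^+ ((n - X - c) + (n - X - d)).
Proof.
move=> leXY lenY lecd cd; have X0 := pow2_neq0 X.
case: (ltnP n c) => cn.
  have [-> -> -> ->] : [/\ n.+1 - c = 0, n.+1 - d = 0, n - c = 0 & n - d = 0]%N by split; lia.
  have [-> ->] : (n - X - c = 0 /\ n - X - d = 0)%N by lia.
  by rewrite adjacent_prob_0_0 !addn0 expr0 mulN1r subrr mulr0 add0r.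
have [-> -> ->] : [/\ n.+1 - d = 0, n - d = 0 & n - X - d = 0]%N by split; lia.
have [w Ew] : exists w, n = (c + w)%N by exists (n - c)%N; lia.
have [-> ->] : (n.+1 - c = w.+1 /\ n - c = w)%N by lia.
rewrite adjacent_prob_l0 // !addn0; case: ltnP => cmp.
  have -> : (n - X - c = 0)%N by lia.
  by rewrite !exprS; field.
have -> : (n - X - c = w - X)%N by lia.
have [z ->] : exists z, w = (X + z)%N by exists (w - X)%N; lia.
by rewrite addKn exprS exprD; field.
Qed.

(** For [Y < c] both blocks survive, with row excess [e]; for [c <= Y] only one does. These two
    regimes determine the coefficients of the counts at [Y] and [Y.+1]. *)
Lemma adjacent_prob_gens_many_cols X Y n c d e :
  (X <= Y)%N -> (Y < n)%N -> (n.+1 + e)%N = (X + Y)%N -> (c <= d)%N ->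
  (c + d)%N = (Y + n.+1)%N ->
  (forall k l, (0 < k)%N -> (0 < l)%N -> (k + l + e)%N = X ->
     adjacent_prob k l X = adjacent_val e) ->
  adjacent_prob (n.+1 - c) (n.+1 - d) X =
  2 ^+ ((n - X - c) + (n - X - d)) +
  ((2 ^+ e.+1)^-1 - 2 * (1 - adjacent_val e)) * 2 ^+ ((Y - c) + (Y - d)) +
  (1 - adjacent_val e - (2 ^+ e.+1)^-1) * 2 ^+ ((Y.+1 - c) + (Y.+1 - d)).
Proof.
move=> leXY ltYn Ee lecd cd PH; have e0 := pow2_neq0 e; have X0 := pow2_neq0 X.
case: (ltnP Y c) => cY.
  rewrite PH; try lia.
  have [-> -> -> ->] : [/\ Y.+1 - c = 0, Y.+1 - d = 0, Y - c = 0 & Y - d = 0]%N by split; lia.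
  have [-> ->] : (n - X - c = 0 /\ n - X - d = 0)%N by lia.
  by rewrite expr0; ring.
have [-> -> -> ->] : [/\ n.+1 - d = 0, Y.+1 - d = 0, Y - d = 0 & n - X - d = 0]%N by split; lia.
have [w Ew] : exists w, Y = (c + w)%N by exists (Y - c)%N; lia.
have [-> ->] : (Y.+1 - c = w.+1 /\ Y - c = w)%N by lia.
rewrite adjacent_prob_l0 ?addn0; last by lia.
case: leqP => cmp.
  have -> : (n - X - c = 0)%N by lia.
  have [x Ex] : exists x, X = (e + x)%N by exists (X - e)%N; lia.
  have -> : (n.+1 - c = x + w)%N by lia.
  have x0 := pow2_neq0 x; rewrite Ex !exprS !exprD expr0; field; by rewrite e0 x0.
have [z Ez] : exists z, w = (e.+1 + z)%N by exists (w - e.+1)%N; lia.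
have -> : (n - X - c = z)%N by lia.
by rewrite Ez !(exprD, exprS); field.
Qed.

Lemma avg_apolar_count3 N k1 k2 k3 x1 x2 x3 :
  (k1 <= N.+1)%N -> (k2 <= N.+1)%N -> (k3 <= N.+1)%N ->
  avg (fun b : 'rV[F]_N => x1 * (apolar_count b k1)%:R +
    x2 * (apolar_count b k2)%:R + x3 * (apolar_count b k3)%:R) =
  x1 * (1 + (2 ^+ k1 - 1) * 2 ^+ k1 / 2 ^+ N.+1) +
  x2 * (1 + (2 ^+ k2 - 1) * 2 ^+ k2 / 2 ^+ N.+1) +
  x3 * (1 + (2 ^+ k3 - 1) * 2 ^+ k3 / 2 ^+ N.+1).
Proof. by move=> l1 l2 l3; rewrite !avgD !avgZ !avg_apolar_count. Qed.

Lemma stacked_prob_few_cols X Y k e :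
  (X <= Y)%N -> (0 < k <= Y.+1)%N -> (k + e)%N = (X + Y)%N ->
  stacked_prob X Y k = stacked_val e k X.
Proof.
case: k => // n leXY /= lenY Ee; rewrite ltnS in lenY.
set N := (Y + n.+1).-1; have EN : N.+1 = (Y + n.+1)%N by rewrite /N; lia.
rewrite /stacked_prob avg_swap -/N.
have E (b : 'rV[F]_N) : avg (fun a : 'rV[F]_(X + n.+1).-1 => (stacked_free X Y n.+1 a b)%:R) =
    (2 ^+ X)^-1 * (apolar_count b n)%:R + - (2 ^+ X)^-1 * (apolar_count b n.+1)%:R +
    1 * (apolar_count b (n - X))%:R.
  have [c [d [p [q [lecd gens]]]]] := apolar_gens_exist b.
  have cd : (c + d)%N = N.+1 by case: gens.
  rewrite (avg_stacked_free leXY _ _ EN gens) //; last by lia.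
  rewrite !(apolar_count_natr gens); try lia.
  by rewrite (adjacent_prob_gens_few_cols leXY lenY lecd) ?cd //; ring.
under eq_avg => b do rewrite E.
rewrite avg_apolar_count3 ?EN; try lia.
have [[X0 Y0] n0] := (pow2_neq0 X, pow2_neq0 Y, pow2_neq0 n).
have eE : 2 ^+ e = 2 ^+ X * 2 ^+ Y / (2 * 2 ^+ n) :> rat.
  by rewrite -exprD -Ee exprD exprS; field.
rewrite /stacked_val; case: (leqP n X) => cmp.
  have -> : minn n.+1 (minn X.+1 (e + 2)) = n.+1 by lia.
  have -> : (n - X = 0)%N by lia.
  rewrite !exprD !exprS expr0 eE; field; by rewrite X0 Y0 n0.
have -> : minn n.+1 (minn X.+1 (e + 2)) = X.+1 by lia.
have [j Ej] : exists j, n = (X + j)%N by exists (n - X)%N; lia.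
have j0 := pow2_neq0 j.
rewrite Ej addKn !(exprD, exprS) expr0 eE Ej !exprD; field; by rewrite X0 Y0 j0.
Qed.

Lemma stacked_prob_many_cols X Y k e : (X <= Y)%N -> (Y.+2 <= k)%N -> (k + e)%N = (X + Y)%N ->
  (forall k l, (0 < k)%N -> (0 < l)%N -> (k + l + e)%N = X ->
     adjacent_prob k l X = adjacent_val e) ->
  stacked_prob X Y k = stacked_val e k X.
Proof.
case: k => // n leXY ltYn Ee PH; rewrite ltnS in ltYn.
set N := (Y + n.+1).-1; have EN : N.+1 = (Y + n.+1)%N by rewrite /N; lia.
rewrite /stacked_prob avg_swap -/N.
have E (b : 'rV[F]_N) : avg (fun a : 'rV[F]_(X + n.+1).-1 => (stacked_free X Y n.+1 a b)%:R) =
    1 * (apolar_count b (n - X))%:R +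
    ((2 ^+ e.+1)^-1 - 2 * (1 - adjacent_val e)) * (apolar_count b Y)%:R +
    (1 - adjacent_val e - (2 ^+ e.+1)^-1) * (apolar_count b Y.+1)%:R.
  have [c [d [p [q [lecd gens]]]]] := apolar_gens_exist b.
  have cd : (c + d)%N = N.+1 by case: gens.
  rewrite (avg_stacked_free leXY _ _ EN gens) //; last by lia.
  rewrite !(apolar_count_natr gens); try lia.
  by rewrite (adjacent_prob_gens_many_cols leXY ltYn Ee lecd) ?cd //; ring.
under eq_avg => b do rewrite E.
rewrite avg_apolar_count3 ?EN; try lia.
have [[X0 Y0] e0] := (pow2_neq0 X, pow2_neq0 Y, pow2_neq0 e).
rewrite /stacked_val /adjacent_val.
have -> : minn n.+1 (minn X.+1 (e + 2)) = (e + 2)%N by lia.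
have nE : 2 ^+ n = 2 ^+ X * 2 ^+ Y / (2 * 2 ^+ e) :> rat.
  by rewrite -exprD -Ee exprD exprS; field.
have jE : 2 ^+ (n - X) = 2 ^+ Y / (2 * 2 ^+ e) :> rat.
  have -> : Y = (n - X + e.+1)%N by lia.
  by rewrite exprD exprS; field.
rewrite jE !(exprD, exprS) expr0 nE; field; by rewrite X0 Y0 e0.
Qed.

(** The dual stacked problem has the same excess [e]. The first two terms give the constant part for
    [l < c]; the third contributes [2^-(minn L (c - l))], up to a factor. For [c <= l] everything
    cancels. *)
Lemma stacked_prob_gens X k l e c d :
  (0 < k)%N -> (k + l.+1 + e)%N = X -> (c <= d)%N -> (c + d)%N = (X + l.+1)%N ->
  (l < c -> stacked_prob (X - d) (X - c) k = stacked_val e k (X - d))%N ->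
  (if (l < c)%N then stacked_prob (X - d) (X - c) k else 0) =
  (2 * (1 - 3 / 2 ^+ (e + 2)) + (2 ^+ e.+1)^-1) * 2 ^+ ((l - c) + (l - d)) +
  (- (1 - 3 / 2 ^+ (e + 2)) - (2 ^+ e.+1)^-1) * 2 ^+ ((l.+1 - c) + (l.+1 - d)) +
  (2 ^+ e.+1)^-1 / 2 ^+ minn k (e + 2) *
     2 ^+ ((l + minn k (e + 2) - c) + (l + minn k (e + 2) - d)).
Proof.
move=> k0 EX lecd cd; set L := minn k (e + 2) => OH.
have [e0 L0] := (pow2_neq0 e, pow2_neq0 L).
have -> : (l + L - d = 0)%N by lia.
have [-> ->] : (l - d = 0 /\ l.+1 - d = 0)%N by lia.
rewrite !addn0; case: ltnP => lc; last first.
  have [w Ew] : exists w, l = (c + w)%N by exists (l - c)%N; lia.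
  have [-> -> ->] : [/\ l.+1 - c = w.+1, l - c = w & l + L - c = w + L]%N by split; lia.
  by rewrite !(exprD, exprS) expr0; field; rewrite e0 L0.
have [-> ->] : (l - c = 0 /\ l.+1 - c = 0)%N by lia.
rewrite OH // /stacked_val.
have -> : (X - d = c - l.+1)%N by lia.
case: (leqP L (c - l)) => cmp.
  have -> : minn k (minn (c - l.+1).+1 (e + 2)) = L by lia.
  have -> : (l + L - c = 0)%N by lia.
  by rewrite !(exprD, exprS) expr0; field; rewrite e0 L0.
have [y Ey] : exists y, c = (l + y.+1)%N by exists (c - l.+1)%N; lia.
have -> : minn k (minn (c - l.+1).+1 (e + 2)) = y.+1 by lia.
have [z Ez] : exists z, L = (y.+1 + z)%N by exists (L - y.+1)%N; lia.
have -> : (l + L - c = z)%N by lia.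
have [y0 z0] := (pow2_neq0 y, pow2_neq0 z).
by rewrite Ez !(exprD, exprS) expr0; field; rewrite e0 y0 z0.
Qed.

(** Induction on the number of columns: fixing the larger block gives a stacked problem of excess
    [e], which is either explicit or again reduces to adjacent blocks. *)
Lemma adjacent_prob_eq k l X e :
  (0 < k)%N -> (0 < l)%N -> (k + l + e)%N = X -> adjacent_prob k l X = adjacent_val e.
Proof.
have [m] := ubnP (k + l); elim: m => // m IHm in k l X e *.
wlog lekl : k l / (k <= l)%N => [wl|].
  case: (leqP k l) => [|/ltnW] le; first exact: wl.
  by move=> ? ? ? ?; rewrite adjacent_probC; apply: wl => //; lia.
case: l lekl => // l lekl ltm k0 _ EX.
set N := flen X l.+1; have EN : N.+1 = (X + l.+1)%N by rewrite /N /=; lia.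
rewrite /adjacent_prob avg_swap -/N.
pose L := minn k (e + 2).
have E (b : 'rV[F]_N) : avg (fun a : 'rV[F]_(flen X k) => (adjacent_free k l.+1 X a b)%:R) =
  (2 * (1 - 3 / 2 ^+ (e + 2)) + (2 ^+ e.+1)^-1) * (apolar_count b l)%:R +
  (- (1 - 3 / 2 ^+ (e + 2)) - (2 ^+ e.+1)^-1) * (apolar_count b l.+1)%:R +
  (2 ^+ e.+1)^-1 / 2 ^+ L * (apolar_count b (l + L))%:R.
  have [c [d [p [q [lecd gens]]]]] := apolar_gens_exist b.
  have cd : (c + d)%N = N.+1 by case: gens.
  rewrite (avg_adjacent_free _ _ EN lecd gens) ?k0 //; last by rewrite flenE //; lia.
  rewrite !(apolar_count_natr gens) ?(@stacked_prob_gens _ _ _ e) ?cd //; try (rewrite /L; lia).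
  move=> lc; case: (leqP k (X - c).+1) => cmp.
    by apply: stacked_prob_few_cols; lia.
  apply: stacked_prob_many_cols; try lia.
  (* The new blocks have [X - d] rows and the same excess, hence [d] columns fewer in total, and [d]
     is positive. *)
  by move=> k' l' k'0 l'0 E'; apply: IHm => //; lia.
under eq_avg => b do rewrite E.
rewrite avg_apolar_count3 ?EN; try (rewrite /L; lia).
have [[l0 e0] kn0] := (pow2_neq0 l, pow2_neq0 e, pow2_neq0 k).
rewrite /adjacent_val -EX /L; case: (leqP k (e + 2)) => cmp.
  by rewrite !(exprD, exprS) expr0; field; rewrite e0 l0 kn0.
by rewrite !(exprD, exprS) expr0; field; rewrite e0 l0 kn0.
Qed.

Lemma stacked_prob_eq X Y k e : (X <= Y)%N -> (0 < k)%N -> (k + e)%N = (X + Y)%N ->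
  stacked_prob X Y k = stacked_val e k X.
Proof.
move=> leXY k0 Ee; case: (leqP k Y.+1) => cmp.
  by apply: stacked_prob_few_cols; rewrite ?k0.
by apply: stacked_prob_many_cols => // k' l' ? ? ?; apply: adjacent_prob_eq.
Qed.

(** * Counting persymmetric matrices *)

Definition hankel X k N (a : 'rV[F]_N) : 'M[F]_(X, k) :=
  \matrix_(i, j) ev a ('X^i * 'X^j).

Lemma hankel_persymmetric X k N (a : 'rV[F]_N) : persymmetric (hankel X k a).
Proof.
apply/forallP => i; apply/forallP => j; apply/forallP => i'; apply/forallP => j'.
by apply/implyP => /eqP E; rewrite !mxE -!exprD E.
Qed.

Lemma persymmetric_hankel X k (A : 'M[F]_(X, k)) :
  persymmetric A -> exists a : 'rV[F]_(X + k).-1, A = hankel X k a.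
Proof.
move=> /forallP persA.
(* Any entry of the anti-diagonal will do by persymmetry; the default 0 is never read in the
   matrix. *)
exists (\row_l (if [pick ij : 'I_X * 'I_k | (ij.1 + ij.2)%N == l] is Some ij
                then A ij.1 ij.2 else 0)).
apply/matrixP => i j; rewrite mxE -exprD.
have ltl : (i + j < (X + k).-1)%N by have := ltn_ord i; have := ltn_ord j; lia.
rewrite (evXn _ (Ordinal ltl)) mxE; case: pickP => [[i' j'] /= E|/(_ (i, j))].
  have /forallP/(_ j)/forallP/(_ i')/forallP/(_ j')/implyP := persA i.
  by rewrite (eqP E) eqxx => /(_ isT)/eqP.
by rewrite /= eqxx.
Qed.

Lemma hankel_inj X k : (0 < X)%N -> (0 < k)%N ->
  injective (@hankel X k (X + k).-1).
Proof.
move=> X0 k0 a b /matrixP E; apply/rowP => l; have ltl := ltn_ord l.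
(* Every index [l] is met by going down the first column and then along the last row. *)
have lti : (minn l X.-1 < X)%N by lia.
have ltj : (l - minn l X.-1 < k)%N by lia.
have := E (Ordinal lti) (Ordinal ltj); rewrite !mxE -!exprD /=.
have -> : (minn l X.-1 + (l - minn l X.-1) = l)%N by lia.
by rewrite !evXn.
Qed.

Lemma rank_hankel_stacked X Y k n1 n2 (a : 'rV[F]_n1) (b : 'rV[F]_n2) :
  (\rank (col_mx (hankel X k a) (hankel Y k b)) == k) = stacked_free X Y k a b.
Proof.
rewrite -mxrank_tr -/(row_free _) tr_col_mx.
have mulH Z n (c : 'rV[F]_n) (f : 'rV[F]_k) :
    (f *m (hankel Z k c)^T == 0) = kill c Z (rVpoly f).
  have E i : (f *m (hankel Z k c)^T) 0 i = ev c (rVpoly f * 'X^i).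
    rewrite mxE rVpoly_sum mulr_suml ev_sum; apply: eq_bigr => j _.
    by rewrite !mxE -scalerAl evZ ['X^i * _]mulrC.
  apply/eqP/forallP => [f0 i|H]; first by rewrite -E f0 mxE.
  by apply/rowP => i; rewrite E (eqP (H i)) mxE.
apply/idP/forallP => [fr f|H].
  apply/implyP => /andP[]; rewrite -!mulH => /eqP fa /eqP fb.
  apply/eqP/(row_free_inj fr); rewrite mul0mx mul_mx_row fa fb row_mx0.
  by [].
apply/inj_row_free => f; rewrite mul_mx_row -[0](row_mx0 _ _ X Y).
move=> /eq_row_mx[/eqP fa /eqP fb]; rewrite !mulH in fa fb.
by have := H f; rewrite fa fb => /eqP.
Qed.

(** Nonempty Hankel matrices correspond bijectively to sequences, and rank [k] with [k] columns is
    full column rank. *)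
Lemma Gamma_stacked_prob s m k : (0 < s)%N -> (0 < k)%N ->
  (Gamma k s m k)%:R = stacked_prob s (s + m) k * 2 ^+ ((s + k).-1 + (s + m + k).-1).
Proof.
move=> s0 k0; set n1 := (s + k).-1; set n2 := (s + m + k).-1.
pose G (x : 'rV[F]_n1 * 'rV[F]_n2) := col_mx (hankel s k x.1) (hankel (s + m) k x.2).
have injG : injective G.
  move=> [a b] [a' b'] /eq_col_mx[/= Ea Eb].
  by rewrite (hankel_inj s0 k0 Ea) (hankel_inj _ k0 Eb) // addn_gt0 s0.
have -> : Gamma k s m k = #|G @: [set x | stacked_free s (s + m) k x.1 x.2]|.
  rewrite /Gamma; congr #|pred_of_set _|; apply/setP => M; rewrite !inE.
  apply/andP/imsetP => [[/existsP[A /existsP[B]]]|[[a b]]].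
    case/and3P => /persymmetric_hankel[a ->] /persymmetric_hankel[b ->] /eqP ->.
    by rewrite rank_hankel_stacked => good; exists (a, b); rewrite ?inE.
  rewrite inE /= => good ->; rewrite rank_hankel_stacked good; split=> //.
  apply/existsP; exists (hankel s k a); apply/existsP; exists (hankel (s + m) k b).
  by rewrite !hankel_persymmetric eqxx.
rewrite card_imset //.
have -> : #|[set x : 'rV[F]_n1 * 'rV[F]_n2 | stacked_free s (s + m) k x.1 x.2]|%:R =
    \sum_(a : 'rV[F]_n1) \sum_(b : 'rV[F]_n2) (stacked_free s (s + m) k a b)%:R :> rat.
  rewrite pair_bigA /= -sum1_card natr_sum big_mkcond; apply: eq_bigr => x _.
  by rewrite inE; case: stacked_free.
rewrite /stacked_prob /avg -mulr_suml !card_F2rV !natrX exprD.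
by rewrite mulrA !divfK ?pow2_neq0.
Qed.

End Binary.

(** * From the probability to the formula in integer powers of two *)

Lemma exprz2_sub (z : int) (n l : nat) :
  z = n%:Z - l%:Z -> (2 : rat) ^ z = 2 ^+ n / 2 ^+ l.
Proof. by move=> ->; rewrite expfzDr // exprnN. Qed.

Theorem theorem2p14 (s m i : nat) (hs : (1 <= s)%N) (hm : (2 <= m)%N) :
  [/\ (1 <= i <= s + 1)%N ->
        (Gamma i s m i)%:R =
          (2 : rat) ^ (2 * s%:Z + 2 * i%:Z + m%:Z - 2)
          - 3 * 2 ^ (3 * i%:Z - 4) + 2 ^ (2 * i%:Z - 3),
      (s + 2 <= i <= s + m + 1)%N ->
        (Gamma i s m i)%:R =
          (2 : rat) ^ (2 * s%:Z + 2 * i%:Z + m%:Z - 2)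
          - 3 * 2 ^ (3 * i%:Z - 4) + 2 ^ (3 * i%:Z - s%:Z - 4)
    & (s + m + 2 <= i <= 2 * s + m)%N ->
        (Gamma i s m i)%:R =
          (2 : rat) ^ (2 * s%:Z + 2 * i%:Z + m%:Z - 2)
          - 3 * 2 ^ (3 * i%:Z - 4) + 2 ^ (4 * i%:Z - 2 * s%:Z - m%:Z - 5)].
Proof.
(* One formula covers all ranges: the minimum is [i], [s.+1] and [e + 2] in turn, where [e] is the
   excess of rows over columns. *)
have main e : (0 < i)%N -> (i + e = s + s + m)%N ->
    (Gamma i s m i)%:R =
      (2 : rat) ^ (2 * s%:Z + 2 * i%:Z + m%:Z - 2) - 3 * 2 ^ (3 * i%:Z - 4) +
      2 ^ (3 * i%:Z - 3 - (minn i (minn s.+1 (e + 2)))%:Z).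
  move=> i0 Ee; rewrite Gamma_stacked_prob // (@stacked_prob_eq _ _ _ e) ?addnA ?leq_addr //.
  rewrite (@exprz2_sub _ (s + s + i + i + m) 2); last by lia.
  rewrite (@exprz2_sub _ (i + i + i) 4); last by lia.
  set L := minn _ _; rewrite (@exprz2_sub _ (i + i + i) (3 + L)); last by lia.
  have eE : 2 ^+ e = 2 ^+ s * 2 ^+ s * 2 ^+ m / 2 ^+ i :> rat.
    by rewrite -!exprD -Ee exprD mulrAC mulfV ?mul1r // pow2_neq0.
  rewrite /stacked_val -/L; case: i i0 Ee @L eE => // n _ Ee L eE.
  have -> : ((s + n.+1).-1 + (s + m + n.+1).-1 = s + n + (s + m + n))%N by lia.
  move: (pow2_neq0 s) (pow2_neq0 m) (pow2_neq0 n) (pow2_neq0 L) => s0 m0 n0 L0.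
  rewrite !(exprD, exprS) expr0 eE exprS; field.
  by rewrite s0 m0 n0 L0.
split=> /andP[i1 i2].
- rewrite (main (s + s + m - i)%N); try lia.
  by congr (_ + 2 ^ _); lia.
- rewrite (main (s + s + m - i)%N); try lia.
  by congr (_ + 2 ^ _); lia.
- rewrite (main (s + s + m - i)%N); try lia.
  by congr (_ + 2 ^ _); lia.
Qed.
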